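(* Let $\Sigma$ be an orientable, complete, non-compact surface embedded in $\mathbb{R}^3$, not totally geodesic, whose second fundamental form goes to zero at infinity, and let $\Omega=\Sigma\times[-a,a]$ be the quantum layer over $\Sigma$, where $a>0$ is such that $\tilde p(x,t)=p(x)+t\vec N_x$ is an embedding of $\Sigma\times[-a,a]$ into $\mathbb{R}^3$. For any $0<\varepsilon<1$, there is a compact set $K$ of $\Sigma$ such that on $\Sigma\setminus K$ (for all $t\in[-a,a]$ and in any local coordinates $(x_1,x_2)$ of $\Sigma$) we have, as inequalities between symmetric matrices, $$(1-\varepsilon)\begin{pmatrix}g_{11}&g_{12}\\ g_{21}&g_{22}\end{pmatrix}\le\begin{pmatrix}G_{11}&G_{12}\\ G_{21}&G_{22}\end{pmatrix}\le(1+\varepsilon)\begin{pmatrix}g_{11}&g_{12}\\ g_{21}&g_{22}\end{pmatrix}.$$ In particular, over $\Sigma\setminus K$ we have $$(1-\varepsilon)^2\,d\Sigma\,dt\le d\Omega\le(1+\varepsilon)^2\,d\Sigma\,dt.$$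
   Context: All surfaces are smooth. Let $p:\Sigma\to\mathbb{R}^3$ be the embedding and $\vec N$ a unit normal vector field of $\Sigma$. The second fundamental form $B$ goes to zero at infinity if for every $\varepsilon>0$ there is a compact subset of $\Sigma$ outside of which $\|B\|<\varepsilon$. The quantum layer is $\Omega=\Sigma\times[-a,a]$ with the Riemannian metric $ds^2_\Omega$ obtained by pulling back the Euclidean metric via $\tilde p$. If $(x_1,x_2)$ are local coordinates on $\Sigma$, then $(x_1,x_2,x_3)$ with $x_3=t$ are local (Fermi) coordinates on $\Omega$. Write $ds^2_\Sigma=\sum_{i,j\le 2} g_{ij}\,dx_i\,dx_j$ for the induced metric of $\Sigma$ and $ds^2_\Omega=\sum_{i,j\le 3} G_{ij}\,dx_i\,dx_j$; thus $G_{ij}=\langle (p+t\vec N)_{x_i},(p+t\vec N)_{x_j}\rangle$ for $1\le i,j\le2$, $G_{i3}=G_{3i}=0$ for $i\ne3$, and $G_{33}=1$. $d\Sigma$ and $d\Omega$ denote the Riemannian volume measures of $\Sigma$ and $\Omega$. For symmetric matrices, $A\le A'$ means that $A'-A$ is positive semidefinite. *)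

(* Defs.v *)
From HB Require Import structures.
From mathcomp Require Import all_boot all_order all_algebra.
From mathcomp Require Import all_classical all_reals all_analysis.

Set Implicit Arguments.
Unset Strict Implicit.
Unset Printing Implicit Defensive.

Import Order.TTheory GRing.Theory Num.Theory.
Import numFieldNormedType.Exports.

Local Open Scope classical_set_scope.
Local Open Scope ring_scope.

Section Calculus.
Variable R : realType.

Definition dotp (m : nat) (v w : 'rV[R]_m) : R := \sum_i v 0 i * w 0 i.

(* [e] lists the coordinate directions of [E], so that ['D_(e i) f] is the i-th
   partial derivative of [f]. *)
Section Coordinates.
Variables (E : normedModType R) (n : nat) (e : 'I_n -> E).

Fixpoint Ck_on (W : normedModType R) (k : nat) (U : set E) (f : E -> W) : Prop :=
  (forall x, U x -> {for x, continuous f}) /\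
  match k with
  | 0%N => True
  | k'.+1 => forall i, (forall x, U x -> derivable f x (e i)) /\
                       Ck_on k' U (fun x => 'D_(e i) f x)
  end.

Definition smooth_on (W : normedModType R) (U : set E) (f : E -> W) : Prop :=
  forall k, Ck_on k U f.

Definition jac (f : E -> 'rV[R]_3) (x : E) : 'M[R]_(n, 3) :=
  \matrix_(i < n) 'D_(e i) f x.

(* The pull-back by [f] of the Euclidean metric. *)
Definition pullback_metric (f : E -> 'rV[R]_3) (x : E) : 'M[R]_n :=
  \matrix_(i < n, j < n) dotp ('D_(e i) f x) ('D_(e j) f x).

End Coordinates.

Definition dir1 (i : 'I_1) : R := 1.
Definition dir2 (i : 'I_2) : (R * R)%type :=
  ((i == 0%N :> nat)%:R, (i == 1%N :> nat)%:R).
Definition dir3 (i : 'I_3) : (R * R * R)%type :=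
  ((i == 0%N :> nat)%:R, (i == 1%N :> nat)%:R, (i == 2%N :> nat)%:R).

Definition psd (m : nat) (A : 'M[R]_m) : Prop :=
  A^T = A /\ forall v : 'rV[R]_m, 0 <= (v *m A *m v^T) 0 0.

Definition mx_le (m : nat) (A A' : 'M[R]_m) : Prop := psd (A' - A).

End Calculus.

Section Surfaces.
Variable R : realType.
Implicit Types (S : set 'rV[R]_3) (N : 'rV[R]_3 -> 'rV[R]_3).
Implicit Types (U : set (R * R)) (phi : R * R -> 'rV[R]_3).

(* [phi] is the inverse of a local coordinate system (x_1, x_2) of [S], defined
   on the relatively open subset [phi @` U] of [S]. *)
Definition local_param S U phi : Prop :=
  [/\ open U,
      smooth_on (@dir2 R) U phi,
      forall u, U u -> row_free (jac (@dir2 R) phi u),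
      (exists2 V : set 'rV[R]_3, open V & phi @` U = S `&` V) &
      exists2 psi : 'rV[R]_3 -> R * R,
        {within phi @` U, continuous psi} & forall u, U u -> psi (phi u) = u].

Definition regular_surface S : Prop :=
  forall x, S x -> exists U phi, local_param S U phi /\ (phi @` U) x.

(* When [phi u = psi v], the matrix [P] below exists, is unique, and is the
   Jacobian matrix at [u] of the change of coordinates. *)
Definition orientable S : Prop :=
  exists A : set (set (R * R) * (R * R -> 'rV[R]_3)),
    [/\ forall c, A c -> local_param S c.1 c.2,
        forall x, S x -> exists2 c, A c & (c.2 @` c.1) x &
        forall c d, A c -> A d ->
          forall u v, c.1 u -> d.1 v -> c.2 u = d.2 v ->
          forall P : 'M[R]_2,
            jac (@dir2 R) c.2 u = P *m jac (@dir2 R) d.2 v -> 0 < \det P].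

Definition tangent S (x : 'rV[R]_3) : set 'rV[R]_3 :=
  [set w | exists U phi u (c : 'rV[R]_2),
     [/\ local_param S U phi, U u, phi u = x & w = c *m jac (@dir2 R) phi u]].

(* The covariant derivative of the velocity is the tangential component of the
   acceleration. *)
Definition geodesic_line S (gamma : R -> 'rV[R]_3) : Prop :=
  [/\ smooth_on (@dir1 R) setT gamma,
      forall s, S (gamma s) &
      forall s w, tangent S (gamma s) w -> dotp (derive1 (derive1 gamma) s) w = 0].

(* Geodesic completeness: the exponential map is defined on the whole tangent
   bundle. *)
Definition complete_surface S : Prop :=
  forall x w, S x -> tangent S x w ->
    exists gamma, [/\ geodesic_line S gamma, gamma 0 = x & derive1 gamma 0 = w].

Definition unit_normal_field S N : Prop :=
  [/\ forall U phi, local_param S U phi ->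
        smooth_on (@dir2 R) U (fun u => N (phi u)),
      forall x, S x -> dotp (N x) (N x) = 1 &
      forall x w, S x -> tangent S x w -> dotp w (N x) = 0].

Definition first_form phi (u : R * R) : 'M[R]_2 :=
  pullback_metric (@dir2 R) phi u.

Definition second_form N phi (u : R * R) : 'M[R]_2 :=
  \matrix_(i < 2, j < 2)
    dotp ('D_(@dir2 R i) (fun u' => 'D_(@dir2 R j) phi u') u) (N (phi u)).

(* The norm of the tensor B with respect to the metric g:
   |B|^2 = g^{ik} g^{jl} h_{ij} h_{kl} = tr (g^-1 h g^-1 h). *)
Definition second_form_norm N phi (u : R * R) : R :=
  let gi := invmx (first_form phi u) in
  let h := second_form N phi u in
  Num.sqrt (\tr (gi *m h *m (gi *m h))).

Definition totally_geodesic S N : Prop :=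
  forall U phi, local_param S U phi ->
  forall u, U u -> second_form N phi u = 0.

Definition compact_subset S (K : set 'rV[R]_3) : Prop := compact K /\ K `<=` S.

Definition second_form_vanishes_at_infinity S N : Prop :=
  forall eps : R, 0 < eps -> exists K, compact_subset S K /\
    forall U phi, local_param S U phi ->
    forall u, U u -> ~ K (phi u) -> second_form_norm N phi u < eps.

Definition layer S (a : R) : set ('rV[R]_3 * R) := S `*` `[- a, a].

Definition layer_map N (xt : 'rV[R]_3 * R) : 'rV[R]_3 := xt.1 + xt.2 *: N xt.1.

Definition fermi_map N phi (ut : R * R * R) : 'rV[R]_3 :=
  layer_map N (phi ut.1, ut.2).

(* [layer_map N] is an injective immersion and a homeomorphism onto its image;
   its smoothness is that of [N]. *)
Definition layer_embedding S N (a : R) : Prop :=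
  [/\ {in layer S a &, injective (layer_map N)},
      forall U phi, local_param S U phi ->
        forall u t, U u -> t \in `[- a, a] ->
        row_free (jac (@dir3 R) (fermi_map N phi) (u, t)) &
      exists2 q : 'rV[R]_3 -> 'rV[R]_3 * R,
        {within layer_map N @` layer S a, continuous q} &
        forall xt, layer S a xt -> q (layer_map N xt) = xt].

Definition layer_metric N phi (u : R * R) (t : R) : 'M[R]_(2 + 1) :=
  pullback_metric (@dir3 R) (fermi_map N phi) (u, t).

(* The block (G_ij), 1 <= i, j <= 2. *)
Definition layer_metric2 N phi (u : R * R) (t : R) : 'M[R]_2 :=
  ulsubmx (layer_metric N phi u t).

(* R^3 with its Borel sigma-algebra. *)
Definition borel3 := g_sigma_algebraType (@open 'rV[R]_3).

Local Notation leb := (@lebesgue_measure R).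

(* The measure on [S] (extended by zero to R^3) which is
   sqrt (det g) dx_1 dx_2 in every local coordinate system. *)
Definition surface_volume S (mu : {measure set borel3 -> \bar R}) : Prop :=
  (forall A : set borel3, measurable A -> A `&` S = set0 -> mu A = 0%E) /\
  (forall U phi, local_param S U phi ->
   forall A : set borel3, measurable A -> A `<=` phi @` U ->
     mu A = (\int[leb \x leb]_(u in U `&` phi @^-1` A)
               (Num.sqrt (\det (first_form phi u)))%:E)%E).

(* The measure on [layer S a] (extended by zero to R^3 x R) which is
   sqrt (det G) dx_1 dx_2 dt in all the local coordinates (x_1, x_2, t). *)
Definition layer_volume S N (a : R)
    (nu : {measure set (borel3 * measurableTypeR R)%type -> \bar R}) : Prop :=
  (forall E : set (borel3 * measurableTypeR R),
     measurable E -> E `&` layer S a = set0 -> nu E = 0%E) /\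
  (forall U phi, local_param S U phi ->
   forall E : set (borel3 * measurableTypeR R),
     measurable E -> E `<=` layer (phi @` U) a ->
     nu E = (\int[(leb \x leb) \x leb]_(ut in
                 [set ut | U ut.1 /\ E (phi ut.1, ut.2)])
               (Num.sqrt (\det (layer_metric N phi ut.1 ut.2)))%:E)%E).

End Surfaces.

(* Main.v *)
Require Import Defs.
From HB Require Import structures.
From mathcomp Require Import all_boot all_order all_algebra.
From mathcomp Require Import all_classical all_reals all_analysis.
From mathcomp Require Import measurable_realfun ring lra.

Import Order.TTheory GRing.Theory Num.Theory.
Import numFieldNormedType.Exports.

Local Open Scope classical_set_scope.
Local Open Scope ring_scope.

(* Outside a compact set the second fundamental form h is small relatively to
   the first fundamental form g. By the Weingarten equations the differential of
   the normal is D = - h g^-1 J, where J is the Jacobian matrix of the chart, so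
   that D D^T = h g^-1 h <= |B|^2 g; the symmetry of h, which is Schwarz's
   theorem, is what identifies |B|^2 with the trace of D D^T relatively to g.
   Since (G_ij) is the Gram matrix of J + t D, it differs from g by at most
   (2 a |B| + a^2 |B|^2) g. As G is block diagonal, comparing the 2x2
   determinants compares the volume densities in a chart. The inequality between
   measures follows by covering Sigma by countably many charts (Lindelof), whose
   images are sigma-compact hence Borel, cutting a measurable set into disjoint
   pieces each lying over one chart, and applying Tonelli's theorem there. *)

(** * Symmetry of second derivatives *)

Section Schwarz.
Context {R : realType} {E : normedModType R}.
Implicit Types (x v w : E) (f : E -> R).

Lemma is_derive_along_line (W : normedModType R) (f : E -> W) x v (s : R) :
  derivable f (x + s *: v) v ->
  is_derive s (1 : R) (fun r => f (x + r *: v)) ('D_v f (x + s *: v)).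
Proof.
move=> df.
have eqq : (fun h : R => h^-1 *: (((fun r => f (x + r *: v)) \o shift s)
     (h *: (1 : R)) - f (x + s *: v)))
  = (fun h => h^-1 *: ((f \o shift (x + s *: v)) (h *: v) - f (x + s *: v))).
  apply/funext => h /=; congr (_ *: (f _ - _)).
  by rewrite [_ *: 1]mulr1 scalerDl addrCA.
by split; rewrite /derivable/derive eqq.
Qed.

(** The mean value theorem is used twice: along [v], for the difference of [f] between the two sides
    of the parallelogram parallel to [v], then along [w], for ['D_v f]. *)
Lemma mixed_difference f x v w (h : R) : 0 < h ->
  (forall s r, s \in `[0, h] -> r \in `[0, h] ->
     derivable f (x + s *: v + r *: w) v /\
     derivable ('D_v f) (x + s *: v + r *: w) w) ->
  exists2 sr : R * R, (sr.1 \in `[0, h]) && (sr.2 \in `[0, h]) &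
    f (x + h *: v + h *: w) - f (x + h *: v) - (f (x + h *: w) - f x) =
    'D_w ('D_v f) (x + sr.1 *: v + sr.2 *: w) * h * h.
Proof.
move=> h0 df.
have hh : h \in `[0, h] by rewrite in_itv /= lexx ltW.
have h00 : 0 \in `[0, h] by rewrite in_itv /= lexx ltW.
pose F s := f (x + h *: w + s *: v) - f (x + s *: v).
pose dF s := 'D_v f (x + h *: w + s *: v) - 'D_v f (x + s *: v).
have dFP s : s \in `[0, h] -> is_derive s (1 : R) F (dF s).
  move=> sh; apply: is_deriveB; apply: is_derive_along_line.
    by rewrite addrAC; apply: (df s h sh hh).1.
  by have := (df s 0 sh h00).1; rewrite scale0r addr0.
have cF : {within `[0, h], continuous F}.
  by apply: derivable_within_continuous => s sh; have [] := dFP s sh.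
have [s sh eF] : exists2 s, s \in `]0, h[ & F h - F 0 = dF s * (h - 0).
  have dd s : s \in `]0, h[ -> is_derive s (1 : R) F (dF s).
    rewrite in_itv /= => /andP[s0 s1].
    have sh : s \in `[0, h] by rewrite in_itv /= !ltW.
    exact: dFP.
  by have := @MVT R F dF 0 h h0 dd cF.
have {}sh : s \in `[0, h].
  by move: sh; rewrite !in_itv /= => /andP[s0 s1]; rewrite !ltW.
pose G r := 'D_v f (x + s *: v + r *: w).
have dGP r : r \in `[0, h] ->
    is_derive r (1 : R) G ('D_w ('D_v f) (x + s *: v + r *: w)).
  by move=> rh; apply: is_derive_along_line; apply: (df s r sh rh).2.
have cG : {within `[0, h], continuous G}.
  by apply: derivable_within_continuous => r rh; have [] := dGP r rh.
have [r rh eG] : exists2 r, r \in `]0, h[ &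
    G h - G 0 = 'D_w ('D_v f) (x + s *: v + r *: w) * (h - 0).
  have dd r : r \in `]0, h[ ->
      is_derive r (1 : R) G ('D_w ('D_v f) (x + s *: v + r *: w)).
    rewrite in_itv /= => /andP[r0 r1].
    have rh : r \in `[0, h] by rewrite in_itv /= !ltW.
    exact: dGP.
  by have := @MVT R G _ 0 h h0 dd cG.
exists (s, r) => /=.
  by rewrite sh; move: rh; rewrite !in_itv /= => /andP[r0 r1]; rewrite !ltW.
move: eF eG; rewrite /F /dF /G !subr0 !scale0r !addr0.
by rewrite [x + h *: w + h *: v]addrAC [x + h *: w + s *: v]addrAC => -> ->.
Qed.

Lemma close_to_common {a b c e : R} :
  `|a - c| < e / 2 -> `|b - c| < e / 2 -> `|b - a| <= e.
Proof.
move=> ac bc; have -> : b - a = (b - c) - (a - c) by ring.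
by rewrite (le_trans (ler_normB _ _))// ltW// [ltRHS]splitr ltrD.
Qed.

(** The second difference of [f] over a small parallelogram is symmetric in [v] and [w], so the two
    mixed derivatives take a common value, at possibly different points of it. By continuity that
    value is within [e / 2] of both mixed derivatives at [x]. *)
Lemma Schwarz f x v w :
  (\forall y \near x, [/\ derivable f y v, derivable f y w,
     derivable ('D_v f) y w & derivable ('D_w f) y v]) ->
  {for x, continuous ('D_w ('D_v f))} -> {for x, continuous ('D_v ('D_w f))} ->
  'D_w ('D_v f) x = 'D_v ('D_w f) x.
Proof.
move=> df cvw cwv; apply/eqP; rewrite eq_sym -subr_eq0 -normr_le0.
apply/ler_addgt0Pl => e e0; rewrite addr0.
pose P y := [/\ derivable f y v /\ derivable f y w,
   derivable ('D_v f) y w, derivable ('D_w f) y v,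
   `|'D_w ('D_v f) x - 'D_w ('D_v f) y| < e / 2 &
   `|'D_v ('D_w f) x - 'D_v ('D_w f) y| < e / 2].
have e20 : 0 < e / 2 by rewrite divr_gt0.
have : \forall y \near x, P y.
  move/cvgrPdist_lt : cvw => /(_ _ e20) c1.
  move/cvgrPdist_lt : cwv => /(_ _ e20) c2.
  apply: filterS2 (filterI c1 c2) df => y [k1 k2] [k3 k4 k5 k6].
  exact (And5 (conj k3 k4) k5 k6 k1 k2).
move=> /nbhs_ballP[d /= d0 dP].
(* With this side the whole parallelogram stays within [d / 2] of [x]; the summand [1] keeps the
   denominator positive when [v] and [w] vanish. *)
pose h := d / 2 / (`|v| + `|w| + 1).
have n1 : 0 < `|v| + `|w| + 1 by rewrite ltr_wpDl// addr_ge0.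
have h0 : 0 < h by rewrite !divr_gt0.
have inP s r : s \in `[0, h] -> r \in `[0, h] -> P (x + s *: v + r *: w).
  rewrite !in_itv /= => /andP[s0 s1] /andP[r0 r1]; apply: dP.
  rewrite -ball_normE /ball_/= -addrA opprD addNKr normrN.
  rewrite (le_lt_trans (ler_normD _ _))// !normrZ !ger0_norm//.
  have lv : s * `|v| <= h * `|v| by rewrite ler_wpM2r.
  have lw : r * `|w| <= h * `|w| by rewrite ler_wpM2r.
  have : h * (`|v| + `|w| + 1) = d / 2 by rewrite /h divfK// gt_eqF.
  rewrite !mulrDr mulr1.
  lra.
have [|[s r] /= /andP[sh rh] e1] := @mixed_difference f x v w h h0.
  by move=> s r sh rh; have [[]] := inP s r sh rh.
have [|[s' r'] /= /andP[s'h r'h] e2] := @mixed_difference f x w v h h0.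
  move=> s' r' sh' rh'; rewrite addrAC.
  by have [[_ dw] _ dwv _ _] := inP r' s' rh' sh'; exact (conj dw dwv).
(* The two second differences are equal after rearrangement, and the factor [h] is cancelled
   twice. *)
have {e1 e2} e12 : 'D_w ('D_v f) (x + s *: v + r *: w) =
    'D_v ('D_w f) (x + r' *: v + s' *: w).
  rewrite [x + s' *: w + _]addrAC in e2.
  apply: (mulIf (lt0r_neq0 h0)); apply: (mulIf (lt0r_neq0 h0)).
  have exch (p q p' q' : R) : p - q - (p' - q') = p - p' - (q - q') by ring.
  rewrite [x + h *: w + _]addrAC in e2.
  exact (etrans (esym e1) (etrans (exch _ _ _ _) e2)).
have [_ _ _ a1 _] := inP _ _ sh rh.
have [_ _ _ _ a2] := inP _ _ r'h s'h.
rewrite e12 in a1.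
exact (close_to_common a1 a2).
Qed.

End Schwarz.

(** * Gram matrices *)

Section LinearAlgebra.
Context {R : realType}.

Lemma dotpE m (v w : 'rV[R]_m) : dotp v w = (v *m w^T) 0 0.
Proof. by rewrite /dotp mxE; apply: eq_bigr => i _; rewrite mxE. Qed.

Lemma dotpC m (v w : 'rV[R]_m) : dotp v w = dotp w v.
Proof. by apply: eq_bigr => i _; rewrite mulrC. Qed.

Lemma dotpDl m (u v w : 'rV[R]_m) : dotp (u + v) w = dotp u w + dotp v w.
Proof. by rewrite !dotpE mulmxDl mxE. Qed.

Lemma dotpDr m (u v w : 'rV[R]_m) : dotp w (u + v) = dotp w u + dotp w v.
Proof. by rewrite !(dotpC _ w) dotpDl. Qed.

Lemma dotpZl m c (v w : 'rV[R]_m) : dotp (c *: v) w = c * dotp v w.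
Proof. by rewrite !dotpE -scalemxAl mxE. Qed.

Lemma dotpZr m c (v w : 'rV[R]_m) : dotp v (c *: w) = c * dotp v w.
Proof. by rewrite !(dotpC _ v) dotpZl. Qed.

Lemma dotp_ge0 m (v : 'rV[R]_m) : 0 <= dotp v v.
Proof. by apply: sumr_ge0 => i _; rewrite -expr2 sqr_ge0. Qed.

Lemma dotp_eq0 m (v : 'rV[R]_m) : dotp v v = 0 -> v = 0.
Proof.
move=> v0; apply/rowP => i; rewrite mxE; apply/eqP.
move/eqP : v0; rewrite psumr_eq0; last by move=> j _; rewrite -expr2 sqr_ge0.
by move/allP => /(_ i); rewrite mem_index_enum /= -expr2 sqrf_eq0; apply.
Qed.

Lemma mulmx_gram m n (A B : 'M[R]_(m, n)) (v : 'rV[R]_m) :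
  (v *m (A *m B^T) *m v^T) 0 0 = dotp (v *m A) (v *m B).
Proof. by rewrite dotpE trmx_mul !mulmxA. Qed.

Lemma gramE m n (A B : 'M[R]_(m, n)) i j :
  (A *m B^T) i j = dotp (row i A) (row j B).
Proof. by rewrite !mxE; apply: eq_bigr => k _; rewrite !mxE. Qed.

(** If [v] is in the kernel of [J *m J^T], then [|v J|^2 = 0], so [v J = 0] and [v = 0]. *)
Lemma gram_unit m n (J : 'M[R]_(m, n)) : row_free J -> J *m J^T \in unitmx.
Proof.
move=> /row_free_inj Jfree; rewrite -row_free_unit -kermx_eq0.
apply/rowV0P => v /sub_kermxP vg.
apply/Jfree; rewrite mul0mx; apply: dotp_eq0.
by rewrite -mulmx_gram vg mul0mx mxE.
Qed.

Lemma quad2 (A : 'M[R]_2) (v : 'rV[R]_2) : (v *m A *m v^T) 0 0 =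
  v 0 0 * v 0 0 * A 0 0 + v 0 0 * v 0 1 * (A 0 1 + A 1 0)
  + v 0 1 * v 0 1 * A 1 1.
Proof.
have e1 : lift ord0 ord0 = 1 :> 'I_2 by apply/val_inj.
rewrite !(mxE, big_ord_recl, big_ord0) /= !e1; ring.
Qed.

Lemma det2 (g : 'M[R]_2) : \det g = g 0 0 * g 1 1 - g 0 1 * g 1 0.
Proof.
have e1 : lift ord0 ord0 = 1 :> 'I_2 by apply/val_inj.
have e0 : lift 1 ord0 = 0 :> 'I_2 by apply/val_inj.
rewrite (expand_det_row _ 0) !(big_ord_recl, big_ord0) /cofactor !det_mx11 !mxE.
rewrite /= !e1 !e0 /= /bump /= !expr0 expr1; ring.
Qed.

Lemma tr_mul2 (A B : 'M[R]_2) : \tr (A *m B) =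
  A 0 0 * B 0 0 + A 0 1 * B 1 0 + (A 1 0 * B 0 1 + A 1 1 * B 1 1).
Proof.
have e1 : lift ord0 ord0 = 1 :> 'I_2 by apply/val_inj.
by rewrite /mxtrace !(mxE, big_ord_recl, big_ord0) /= !e1 !addr0.
Qed.

Lemma adj2 (g : 'M[R]_2) :
  [/\ \adj g 0 0 = g 1 1, \adj g 0 1 = - g 0 1,
      \adj g 1 0 = - g 1 0 & \adj g 1 1 = g 0 0].
Proof.
have e1 : lift 0 0 = 1 :> 'I_2 by apply/val_inj.
have e0 : lift 1 0 = 0 :> 'I_2 by apply/val_inj.
by split; rewrite mxE /cofactor det_mx11 !mxE ?e1 ?e0 /= ?expr0 ?mul1r ?mulN1r
  // sqrrN ?expr1n ?mul1r.
Qed.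

(* The difference of the two sides, times det g, is the value of A at a vector
   that is g-orthogonal to v. *)
Lemma psd_le_trace (g A : 'M[R]_2) (v : 'rV[R]_2) : g^T = g ->
  0 < \det g -> psd A ->
  (v *m A *m v^T) 0 0 <= \tr (invmx g *m A) * (v *m g *m v^T) 0 0.
Proof.
move=> gT g0 [AT Ap].
have gu : g \in unitmx by rewrite unitmxE unitfE gt_eqF.
rewrite /invmx gu -scalemxAl mxtraceZ -mulrA ler_pdivlMl//.
(* This is [v *m g] turned by a right angle, whence [w g v^T = 0]. *)
pose w : 'rV[R]_2 := \row_j
  if j == 0 then - (v *m g) 0 1 else (v *m g) 0 0.
rewrite -subr_ge0; apply: le_trans (Ap w) _; rewrite le_eqVlt; apply/orP; left.
have g10 : g 1 0 = g 0 1 by rewrite -[in LHS]gT mxE.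
have A10 : A 1 0 = A 0 1 by rewrite -[in LHS]AT mxE.
have [a00 a01 a10 a11] := adj2 g.
have e1 : lift ord0 ord0 = 1 :> 'I_2 by apply/val_inj.
apply/eqP; rewrite det2 tr_mul2 !quad2 a00 a01 a10 a11.
rewrite !(mxE, big_ord_recl, big_ord0) /= !e1 g10 A10; ring.
Qed.

Lemma gram_psd m n (J : 'M[R]_(m, n)) : psd (J *m J^T).
Proof.
split; first by rewrite trmx_mul trmxK.
by move=> v; rewrite mulmx_gram dotp_ge0.
Qed.

Lemma psd2_ge0 (A : 'M[R]_2) : psd A ->
  [/\ A 1 0 = A 0 1, 0 <= A 0 0, 0 <= A 1 1 & A 0 1 * A 0 1 <= A 0 0 * A 1 1].
Proof.
move=> [AT Ap].
have A10 : A 1 0 = A 0 1 by rewrite -[in LHS]AT mxE.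
have q (x y : R) : 0 <= x * x * A 0 0 + x * y * (A 0 1 + A 0 1) + y * y * A 1 1.
  have := Ap (\row_j if j == 0 then x else y).
  by rewrite quad2 !mxE /= A10.
have A00 : 0 <= A 0 0 by have := q 1 0; lra.
have A11 : 0 <= A 1 1 by have := q 0 1; lra.
split => //.
(* At these vectors the form equals [\det A] times [A 0 0], respectively [A 1 1], which settles the
   case of a nonzero diagonal entry. If both vanish, the vectors [(1, 1)] and [(1, -1)] force
   [A 0 1 = 0]. *)
have := q (A 0 1) (- A 0 0); have := q (- A 1 1) (A 0 1).
case: (ltrgtP (A 0 0) 0) => // [|A00'|A00'] ; [by lra|nra|].
case: (ltrgtP (A 1 1) 0) => // [|A11'|A11'] ; [by lra|nra|].
by have := q 1 1; have := q 1 (-1); rewrite A00' A11'; nra.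
Qed.

(** Let [a, b, d] be the entries of [A] and [p, q, s] those of [C = B - A]. Then [\det B] is
    [\det A + \det C] plus the mixed term [a s + d p - 2 b q]. From [b^2 <= a d] and [q^2 <= p s]
    comes [(b q)^2 <= (a s) (d p)], and the inequality of arithmetic and geometric means makes the
    mixed term non-negative. *)
Lemma psd2_det_le (A B : 'M[R]_2) : psd A -> mx_le A B -> \det A <= \det B.
Proof.
move=> /psd2_ge0[A10 A00 A11 Ad] /psd2_ge0; rewrite !det2 !mxE.
set p := B 0 0; set q := B 0 1; set r := B 1 0; set s := B 1 1.
move=> [C10 C00 C11 Cd]; have -> : r = q by move: C10; rewrite A10; lra.
rewrite A10; move: A00 A11 Ad C00 C11 Cd {C10 A10}.
set a := A 0 0; set b := A 0 1; set d := A 1 1.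
have -> : p = a + (p - a) by ring.
have -> : q = b + (q - b) by ring.
have -> : s = d + (s - d) by ring.
(* From here on [p], [q], [s] are the entries of [B - A]. *)
move: a b d (p - a) (q - b) (s - d) => {p q r s} a b d p q s.
rewrite ![_ + _ - _]addrAC !subrr !add0r => a0 d0 ad p0 s0 ps.
have as0 : 0 <= a * s by apply: mulr_ge0.
have dp0 : 0 <= d * p by apply: mulr_ge0.
have m2 : (b * q) ^+ 2 <= (a * s) * (d * p).
  have -> : (b * q) ^+ 2 = (b * b) * (q * q) by ring.
  have -> : (a * s) * (d * p) = (a * d) * (p * s) by ring.
  by apply: ler_pM; rewrite -?expr2 ?sqr_ge0.
have : 2 * (b * q) <= a * s + d * p.
  rewrite leNgt; apply/negP => lt.
  have : (a * s + d * p) ^+ 2 < (2 * (b * q)) ^+ 2.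
    by rewrite ltrXn2r// addr_ge0.
  have := sqr_ge0 (a * s - d * p); nra.
nra.
Qed.

Lemma gram_det_gt0 n (J : 'M[R]_(2, n)) : row_free J -> 0 < \det (J *m J^T).
Proof.
move=> Jfree; rewrite lt_neqAle eq_sym -unitfE -unitmxE gram_unit//=.
have [g10 _ _ g2] := psd2_ge0 _ (gram_psd _ _ J).
by rewrite det2 g10 subr_ge0.
Qed.

(* J is tangent, n the unit normal and D the differential of n: D is -h g^-1 J
   by the Weingarten equations, so that D D^T = h g^-1 h. *)
Lemma weingarten_bound (J D : 'M[R]_(2, 3)) (n : 'rV[R]_3) (v : 'rV[R]_2) :
  row_free J -> J *m n^T = 0 -> D *m n^T = 0 -> n *m n^T = 1%:M ->
  let g := J *m J^T in let h := - (D *m J^T) in h^T = h ->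
  dotp (v *m D) (v *m D) <=
    \tr (invmx g *m h *m (invmx g *m h)) * dotp (v *m J) (v *m J).
Proof.
move=> Jfree Jn Dn nn g h hT.
have gu : g \in unitmx := gram_unit _ _ _ Jfree.
have DE : D = - (h *m invmx g *m J).
  (* The rows of [M] form the moving frame. As [M *m M^T] is block diagonal with blocks [g] and [1],
     [M] is invertible, and the formula for [D] can be checked after multiplication by [J^T] and by
     [n^T]. *)
  pose M : 'M[R]_(2 + 1, 3) := col_mx J n.
  have Mu : M^T \in unitmx.
    have : M *m M^T \in unitmx.
      rewrite /M tr_col_mx mul_col_row Jn nn.
      have -> : n *m J^T = 0 by rewrite -[LHS]trmxK trmx_mul trmxK Jn trmx0.
      by rewrite unitmxE det_ublock det1 mulr1 -unitmxE.
    by rewrite unitmx_mul => /andP[].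
  apply: (row_free_inj (n := 3) (A := M^T)); first by rewrite row_free_unit.
  rewrite /M tr_col_mx !mul_mx_row Dn !mulNmx -!mulmxA Jn !mulmx0.
  rewrite mulVmx// mulmx1 /h opprK.
  by rewrite !oppr0.
have gT : g^T = g by rewrite trmx_mul trmxK.
have DD : D *m D^T = h *m invmx g *m h.
  rewrite DE linearN/= mulmxN mulNmx opprK !trmx_mul hT trmx_inv gT.
  rewrite -!mulmxA; congr (_ *m _).
  by rewrite !mulmxA -(mulmxA _ J) mulVmx// mul1mx.
rewrite -!mulmx_gram -/g DD.
have := @psd_le_trace g (D *m D^T) v gT (gram_det_gt0 _ _ Jfree)
  (gram_psd _ _ D).
by rewrite DD -!mulmxA.
Qed.

(** Write [x], [y], [z] for the products [X.X], [Y.Y], [X.Y]. The difference is [2 t z + t^2 y], and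
    the non-negativity of [|d X + Y|^2] and [|d X - Y|^2] gives [|z| <= d x], a Cauchy-Schwarz bound
    free of square roots. *)
Lemma perturbed_gram_bounds {m} (X Y : 'rV[R]_m) (d t a : R) :
  0 < d -> - a <= t <= a -> dotp Y Y <= d ^+ 2 * dotp X X ->
  `|dotp (X + t *: Y) (X + t *: Y) - dotp X X| <=
     (2 * (a * d) + (a * d) ^+ 2) * dotp X X.
Proof.
move=> d0 /andP[ta1 ta2] dY.
have p1 := dotp_ge0 _ (d *: X + Y); have p2 := dotp_ge0 _ (d *: X - Y).
rewrite -(scaleN1r Y) in p2; move: p1 p2.
rewrite !(dotpDl, dotpDr, dotpZl, dotpZr) (dotpC _ Y X).
have := dotp_ge0 _ X; have := dotp_ge0 _ Y; move: dY.
set x := dotp X X; set y := dotp Y Y; set z := dotp X Y => dY y0 x0 p1 p2.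
have a0 : 0 <= a by lra.
have z1 : - (d * x) <= z by rewrite -(ler_pM2l d0); nra.
have z2 : z <= d * x by rewrite -(ler_pM2l d0); nra.
have tt : t * t <= a ^+ 2 by nra.
have ty : t * t * y <= a ^+ 2 * (d ^+ 2 * x) by apply: ler_pM => //; nra.
have ty0 : 0 <= t * t * y by apply: mulr_ge0 => //; nra.
have tz : `|t * z| <= a * (d * x).
  by rewrite normrM ler_pM// ler_norml ?ta1// z1.
move: tz; rewrite !ler_norml => /andP[tz1 tz2]; apply/andP; split; nra.
Qed.

End LinearAlgebra.

(** * Derivatives of maps into row vectors *)

Section VectorCalculus.
Context {R : realType} {E : normedModType R}.

Lemma derive_coord m (f : E -> 'rV[R]_m) x v k : derivable f x v ->
  'D_v f x 0 k = 'D_v (fun y => f y 0 k) x.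
Proof. by move=> df; rewrite (derive_mx df) mxE. Qed.

Lemma derive_dotp m (f g : E -> 'rV[R]_m) x v :
  derivable f x v -> derivable g x v ->
  'D_v (fun y => dotp (f y) (g y)) x =
  dotp ('D_v f x) (g x) + dotp (f x) ('D_v g x).
Proof.
move=> df dg.
have dfk k : derivable (fun y => f y 0 k) x v.
  by have [H _] := derivable_mxP f x v; exact (H df 0 k).
have dgk k : derivable (fun y => g y 0 k) x v.
  by have [H _] := derivable_mxP g x v; exact (H dg 0 k).
have -> : (fun y => dotp (f y) (g y)) =
    \sum_(k < m) ((fun y => f y 0 k) * (fun y => g y 0 k)).
  by apply/funext => y; rewrite fct_sumE.
rewrite derive_sum; last by move=> k; apply: derivableM.
rewrite /dotp -big_split; apply: eq_bigr => k _.
rewrite deriveM//= !derive_coord//.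
by rewrite addrC; congr (_ + _); rewrite [LHS]mulrC.
Qed.

(** Schwarz's theorem holds coordinate by coordinate. Taking a coordinate commutes with a derivative
    at points of derivability; to iterate this, the equality of first derivatives is needed on a
    neighbourhood, hence the open set [U]. *)
Lemma Schwarz_rV m (f : E -> 'rV[R]_m) (U : set E) x v w :
  open U -> U x ->
  (forall y, U y -> [/\ derivable f y v, derivable f y w,
     derivable ('D_v f) y w & derivable ('D_w f) y v]) ->
  {for x, continuous ('D_w ('D_v f))} -> {for x, continuous ('D_v ('D_w f))} ->
  'D_w ('D_v f) x = 'D_v ('D_w f) x.
Proof.
move=> Uo Ux df cvw cwv; apply/rowP => k.
have coordd v' y : U y -> derivable f y v' ->
    derivable (fun z => f z 0 k) y v'.
  by move=> Uy; have [H _] := derivable_mxP f y v' => /H.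
have nU y : U y -> \forall z \near y, U z by move=> Uy; exact: open_nbhs_nbhs.
have near1 v' y : U y -> (forall z, U z -> derivable f z v') ->
   {near y, (fun z => 'D_v' f z 0 k) =1 'D_v' (fun z => f z 0 k)}.
  by move=> Uy dv'; apply: filterS (nU y Uy) => z Uz; apply/derive_coord/dv'.
have dv y : U y -> derivable f y v by move=> /df[].
have dw y : U y -> derivable f y w by move=> /df[].
have dvw y : U y -> derivable ('D_v f) y w by move=> /df[].
have dwv y : U y -> derivable ('D_w f) y v by move=> /df[].
have second v' w' y : U y -> (forall z, U z -> derivable f z v') ->
    derivable ('D_v' f) y w' ->
    'D_w' ('D_v' f) y 0 k = 'D_w' ('D_v' (fun z => f z 0 k)) y /\
    derivable ('D_v' (fun z => f z 0 k)) y w'.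
  move=> Uy dv' dy; rewrite derive_coord//; split.
    by apply: near_eq_derive; apply: near1.
  apply: near_eq_derivable; first exact: near1.
  by have [H _] := derivable_mxP ('D_v' f) y w'; apply: H.
have [e1 _] := second v w x Ux dv (dvw x Ux).
have [e2 _] := second w v x Ux dw (dwv x Ux).
refine (etrans e1 (etrans _ (esym e2))).
have coordc (F : E -> 'rV[R]_m) (G : E -> R) :
    {for x, continuous F} -> (forall y, U y -> F y 0 k = G y) ->
    {for x, continuous G}.
  move=> cF FG; rewrite /prop_for /continuous_at -(FG x Ux).
  have /near_eq_cvg H : {near x, (fun y => F y 0 k) =1 G}.
    by apply: filterS (nU x Ux).
  apply: cvg_trans H _.
  exact: (continuous_comp cF (@coord_continuous _ _ _ 0 k _)).
apply: Schwarz.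
- apply: filterS (nU x Ux) => y Uy.
  exact (And4 (coordd v y Uy (dv y Uy)) (coordd w y Uy (dw y Uy))
    (second v w y Uy dv (dvw y Uy)).2 (second w v y Uy dw (dwv y Uy)).2).
- by apply: coordc cvw _ => y Uy; exact: (second v w y Uy dv (dvw y Uy)).1.
- by apply: coordc cwv _ => y Uy; exact: (second w v y Uy dw (dwv y Uy)).1.
Qed.

End VectorCalculus.

(** * Geometry of the layer over a chart *)

Section ChartGeometry.
Context {R : realType} (S : set 'rV[R]_3) (N : 'rV[R]_3 -> 'rV[R]_3).
Context (U : set (R * R)) (phi : R * R -> 'rV[R]_3).
Hypotheses (SU : local_param S U phi) (NS : unit_normal_field S N).

Let e := @dir2 R.
Let Nphi u := N (phi u).

Lemma chart_open : open U. Proof. by case: SU. Qed.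

Lemma chart_in u : U u -> S (phi u).
Proof.
case: SU => _ _ _ [V _ UV] _ Uu.
by have [] : (S `&` V) (phi u) by rewrite -UV; exists u.
Qed.

Lemma chart_smooth : smooth_on e U phi. Proof. by case: SU. Qed.

Lemma normal_smooth : smooth_on e U Nphi.
Proof. by case: NS => + _ _; apply. Qed.

Lemma smooth_derivable (f : R * R -> 'rV[R]_3) i u : smooth_on e U f -> U u ->
  derivable f u (e i).
Proof. by move=> /(_ 1%N)[_ /(_ i)[+ _]]; apply. Qed.

Lemma smooth_continuous (f : R * R -> 'rV[R]_3) u : smooth_on e U f -> U u ->
  {for u, continuous f}.
Proof. by move=> /(_ 0%N)[+ _]; apply. Qed.

Lemma smooth_derive (f : R * R -> 'rV[R]_3) i : smooth_on e U f ->
  smooth_on e U ('D_(e i) f).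
Proof. by move=> fs k; have [_ /(_ i)[_]] := fs k.+1. Qed.

Lemma jac_tangent u i : U u -> dotp ('D_(e i) phi u) (Nphi u) = 0.
Proof.
move=> Uu; case: NS => _ _ /(_ (phi u)); apply; first exact: chart_in.
exists U, phi, u, (delta_mx 0 i); split => //.
by rewrite -rowE rowK.
Qed.

Lemma near_chart u (P : R * R -> Prop) : (forall y, U y -> P y) -> U u ->
  \forall y \near u, P y.
Proof.
move=> UP Uu; have : \forall y \near u, U y.
  by apply: open_nbhs_nbhs; split => //; exact: chart_open.
by apply: filterS.
Qed.

(** Differentiating [<phi_j, N> = 0] along [e i] gives [<phi_ij, N> = - <phi_j, N_i>]. *)
Lemma second_formE u : U u ->
  second_form N phi u = - (jac e Nphi u *m (jac e phi u)^T).
Proof.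
move=> Uu; apply/matrixP => i j.
have : 'D_(e i) (fun y => dotp ('D_(e j) phi y) (Nphi y)) u = 0.
  rewrite -(derive_cst 0 u (e i)); apply: near_eq_derive.
  by apply: near_chart => // y Uy; exact: jac_tangent.
rewrite derive_dotp; last 2 first.
- exact (smooth_derivable _ i u (smooth_derive _ j chart_smooth) Uu).
- exact (smooth_derivable _ i u normal_smooth Uu).
move=> /eqP; rewrite addr_eq0 => /eqP h0.
rewrite mxE; apply: (etrans h0); rewrite mxE; congr (- _).
by rewrite dotpC gramE !rowK.
Qed.

Lemma second_form_sym u : U u -> (second_form N phi u)^T = second_form N phi u.
Proof.
move=> Uu; apply/matrixP => i j; rewrite !mxE.
refine (congr1 (fun w => dotp w _) _).
have sm i' j' := smooth_derive _ i' (smooth_derive _ j' chart_smooth).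
apply: (Schwarz_rV _ _ U).
- exact: chart_open.
- exact Uu.
- move=> y Uy.
  exact (And4 (smooth_derivable _ i y chart_smooth Uy)
    (smooth_derivable _ j y chart_smooth Uy)
    (smooth_derivable _ j y (smooth_derive _ i chart_smooth) Uy)
    (smooth_derivable _ i y (smooth_derive _ j chart_smooth) Uy)).
- exact (smooth_continuous _ u (sm j i) Uu).
- exact (smooth_continuous _ u (sm i j) Uu).
Qed.

Lemma normal_unit u : U u -> Nphi u *m (Nphi u)^T = 1%:M.
Proof.
move=> Uu; apply/matrixP => i j; rewrite !ord1 -dotpE mxE.
by case: NS => _ /(_ (phi u)) + _; apply; exact: chart_in.
Qed.

Lemma jac_normal0 u : U u -> jac e phi u *m (Nphi u)^T = 0.
Proof.
move=> Uu; apply/row_matrixP => i; rewrite row_mul rowK row0.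
by apply/matrixP => k l; rewrite !ord1 -dotpE jac_tangent// mxE.
Qed.

(** Differentiating [<N, N> = 1] gives [2 <N_i, N> = 0]. *)
Lemma jacN_normal0 u : U u -> jac e Nphi u *m (Nphi u)^T = 0.
Proof.
move=> Uu; apply/row_matrixP => i; rewrite row_mul rowK row0.
apply/matrixP => k l; rewrite !ord1 -dotpE mxE.
have : 'D_(e i) (fun y => dotp (Nphi y) (Nphi y)) u = 0.
  rewrite -(derive_cst (1 : R) u (e i)); apply: near_eq_derive.
  apply: near_chart => // y Uy.
  by case: NS => _ /(_ (phi y)) + _; apply; exact: chart_in.
have dN := smooth_derivable _ i u normal_smooth Uu.
rewrite derive_dotp; [|exact dN|exact dN].
rewrite (dotpC _ (Nphi u)) => H; lra.
Qed.

Lemma first_formE u : first_form phi u = jac e phi u *m (jac e phi u)^T.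
Proof.
by apply/matrixP => i j; rewrite gramE !rowK mxE.
Qed.

(** Moving along [(e i, 0)] keeps [t] fixed, so the difference quotient is exactly that of
    [phi + t N] at [u]. *)
Lemma derive_fermi_tangent u t i : U u ->
  'D_(e i, 0) (fermi_map N phi) (u, t) =
  'D_(e i) phi u + t *: 'D_(e i) Nphi u.
Proof.
move=> Uu.
have dp := smooth_derivable _ i u chart_smooth Uu.
have dN := smooth_derivable _ i u normal_smooth Uu.
have dtN : derivable (t \*: Nphi) u (e i) by apply: derivableZ; exact dN.
rewrite -(deriveZ t dN) -(deriveD dp dtN) /derive.
have -> : (fun h : R => h^-1 *:
     ((fermi_map N phi \o shift (u, t)) (h *: (e i, 0)) -
      fermi_map N phi (u, t))) =
   (fun h => h^-1 *: (((phi + t \*: Nphi) \o shift u) (h *: e i) -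
     (phi + t \*: Nphi) u)).
  apply/funext => h; rewrite /fermi_map /layer_map /= scaler0 add0r.
  reflexivity.
reflexivity.
Qed.

(** The Fermi map is affine in [t], so every difference quotient with [h != 0] already equals the
    normal. *)
Lemma derive_fermi_normal u t :
  'D_(0, 1) (fermi_map N phi) (u, t) = Nphi u.
Proof.
apply/lim_near_cst => //=; near=> h.
have h0 : h != 0 by near: h; exact: nbhs_dnbhs_neq.
rewrite /fermi_map /layer_map /= scaler0 add0r.
rewrite [_ + t]addrC opprD addrACA subrr add0r -scalerBl addrAC subrr add0r.
by rewrite scalerA [_ *: 1]mulr1 mulVf// scale1r.
Unshelve. all: by end_near. Qed.

Lemma layer_metric2E u t : U u -> layer_metric2 N phi u t =
  (jac e phi u + t *: jac e Nphi u) *m (jac e phi u + t *: jac e Nphi u)^T.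
Proof.
move=> Uu; apply/matrixP => i j.
have dE (k : 'I_2) : dir3 R (lshift 1 k) = (e k, 0).
  by rewrite /dir3 /e /dir2 /=; congr (_, _, _); case: k => -[|[|]].
rewrite gramE !mxE !dE !derive_fermi_tangent//.
by rewrite !linearD /= !linearZ /= !rowK.
Qed.

(** Both [phi_i] and [N_i] are orthogonal to [N], so [G_i3 = 0], while [G_33 = |N|^2 = 1]. *)
Lemma det_layer_metric u t : U u ->
  \det (layer_metric N phi u t) = \det (layer_metric2 N phi u t).
Proof.
move=> Uu.
have d3 : dir3 R (rshift 2 ord0) = ((0, 0), 1) by [].
have dE (k : 'I_2) : dir3 R (lshift 1 k) = (e k, 0).
  by rewrite /dir3 /e /dir2 /=; congr (_, _, _); case: k => -[|[|]].
rewrite -[layer_metric N phi u t]submxK.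
have -> : ursubmx (layer_metric N phi u t) = 0.
  apply/matrixP => i j; rewrite ord1 !mxE d3 dE derive_fermi_tangent//.
  rewrite derive_fermi_normal dotpDl dotpZl jac_tangent// add0r.
  have /matrixP/(_ i 0) := jacN_normal0 u Uu; rewrite !mxE => H.
  have -> : dotp ('D_(e i) Nphi u) (Nphi u) = 0.
    by rewrite -[RHS]H; apply: eq_bigr => k _; rewrite !mxE.
  by rewrite mulr0.
rewrite det_lblock.
have -> : drsubmx (layer_metric N phi u t) = 1%:M.
  apply/matrixP => i j; rewrite !ord1 !mxE d3 derive_fermi_normal.
  by have /matrixP/(_ 0 0) := normal_unit u Uu; rewrite -dotpE mxE.
by rewrite det1 mulr1.
Qed.

Lemma layer_metric2_bounds (a d t : R) u (v : 'rV[R]_2) : 0 < d -> U u ->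
  second_form_norm N phi u < d -> - a <= t <= a ->
  `|(v *m layer_metric2 N phi u t *m v^T) 0 0 -
    (v *m first_form phi u *m v^T) 0 0| <=
  (2 * (a * d) + (a * d) ^+ 2) * (v *m first_form phi u *m v^T) 0 0.
Proof.
move=> d0 Uu Bd ta; rewrite layer_metric2E// first_formE !mulmx_gram.
rewrite mulmxDr -scalemxAr; apply: perturbed_gram_bounds => //.
have Jfree : row_free (jac e phi u) by case: SU => _ _ + _ _; apply.
have := @weingarten_bound _ (jac e phi u) (jac e Nphi u) (Nphi u) v Jfree
   (jac_normal0 u Uu) (jacN_normal0 u Uu) (normal_unit u Uu).
rewrite /= -second_formE// -first_formE => /(_ (second_form_sym u Uu)) H.
apply: (le_trans H); rewrite ler_wpM2r ?dotp_ge0//.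
move: Bd; rewrite /second_form_norm /=; set tau := \tr _ => Bd.
(* [Num.sqrt] is [0] on negative numbers, so the bound on the norm controls [tau] only when [tau] is
   non-negative; otherwise [tau <= d ^+ 2] is immediate. *)
have [tau0|/ltW tau0] := leP 0 tau; last by rewrite (le_trans tau0)// sqr_ge0.
by rewrite -[tau]sqr_sqrtr// ltW// ltrXn2r// ?sqrtr_ge0.
Qed.

(** With [d = eps / 3 / a] the relative error is [2 (eps / 3) + (eps / 3)^2], which is at most [eps]
    because [eps < 1]. *)
Lemma layer_metric_bounds (a eps t : R) u : 0 < a -> 0 < eps -> eps < 1 ->
  U u -> second_form_norm N phi u < eps / 3 / a -> - a <= t <= a ->
  mx_le ((1 - eps) *: first_form phi u) (layer_metric2 N phi u t) /\
  mx_le (layer_metric2 N phi u t) ((1 + eps) *: first_form phi u).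
Proof.
move=> a0 eps0 eps1 Uu Bd ta.
have d0 : 0 < eps / 3 / a by rewrite !divr_gt0.
have gT : (first_form phi u)^T = first_form phi u.
  by rewrite first_formE trmx_mul trmxK.
have GT : (layer_metric2 N phi u t)^T = layer_metric2 N phi u t.
  by rewrite layer_metric2E// trmx_mul trmxK.
have quad (v : 'rV[R]_2) : `|(v *m layer_metric2 N phi u t *m v^T) 0 0 -
    (v *m first_form phi u *m v^T) 0 0| <=
    eps * (v *m first_form phi u *m v^T) 0 0.
  apply: (le_trans (layer_metric2_bounds a _ t u v d0 Uu Bd ta)).
  rewrite [a * _]mulrC divfK ?gt_eqF//; apply: ler_wpM2r; last nra.
  by rewrite first_formE mulmx_gram dotp_ge0.
split; split => [|v].
- by rewrite linearB/= linearZ/= gT GT.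
- rewrite mulmxBr mulmxBl -!scalemxAr -!scalemxAl.
  by have := quad v; rewrite !mxE ler_norml => /andP[]; lra.
- by rewrite linearB/= linearZ/= gT GT.
- rewrite mulmxBr mulmxBl -!scalemxAr -!scalemxAl.
  by have := quad v; rewrite !mxE ler_norml => /andP[]; lra.
Qed.

Lemma sqrt_det_layer_metric_bounds (a eps t : R) u :
  0 < a -> 0 < eps -> eps < 1 -> U u ->
  second_form_norm N phi u < eps / 3 / a -> - a <= t <= a ->
  (1 - eps) ^+ 2 * Num.sqrt (\det (first_form phi u)) <=
    Num.sqrt (\det (layer_metric N phi u t)) <=
  (1 + eps) ^+ 2 * Num.sqrt (\det (first_form phi u)).
Proof.
move=> a0 eps0 eps1 Uu Bd ta; rewrite det_layer_metric//.
have [lo hi] := layer_metric_bounds a eps t u a0 eps0 eps1 Uu Bd ta.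
have gp : psd (first_form phi u) by rewrite first_formE; exact: gram_psd.
have Gp : psd (layer_metric2 N phi u t).
  by rewrite layer_metric2E//; exact: gram_psd.
have sp : psd ((1 - eps) *: first_form phi u).
  case: gp => gT gp; split; first by rewrite linearZ/= gT.
  by move=> v; rewrite -scalemxAr -scalemxAl mxE mulr_ge0// subr_ge0 ltW.
have /ler_wsqrtr := psd2_det_le _ _ sp lo.
have /ler_wsqrtr := psd2_det_le _ _ Gp hi.
(* A determinant of order two scales by the square, so its root carries the factor [1 - eps] or
   [1 + eps]. The squared factors follow from [(1 - eps)^2 <= 1 - eps] and
   [1 + eps <= (1 + eps)^2]. *)
rewrite !detZ ![Num.sqrt (_ * \det _)]sqrtrM ?sqr_ge0// !sqrtr_sqr.
rewrite !ger0_norm; [|lra|lra].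
have := sqrtr_ge0 (\det (first_form phi u)) => s0 hi' lo'.
apply/andP; split; [apply: le_trans lo'|apply: (le_trans hi')];
  rewrite ler_wpM2r//; nra.
Qed.

End ChartGeometry.

(** * Borel sets of the plane and of the space *)

Section Topology.
Context {R : realType}.

Local Notation T2 := (measurableTypeR R * measurableTypeR R)%type.

Lemma inv_succ_lt (e : R) : 0 < e -> exists j : nat, j.+1%:R^-1 < e.
Proof.
move=> e0; have [j _ /(_ j (leqnn _))] : \forall j \near \oo, j.+1%:R^-1 < e.
  exact: near_infty_natSinv_lt (PosNum e0).
by exists j.
Qed.

Lemma rat_approx (x e : R) : 0 < e -> exists q : rat, `|x - ratr q| < e.
Proof.
move=> e0; have [] := @dense_rat R (ball x e).
- by exists x; exact: ballxx.
- exact: ball_open.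
by move=> y [+ [q _ qy]]; rewrite -ball_normE -qy => H; exists q.
Qed.

(** A countable family of squares with rational centres, taken closed so that they are compact and
    so are their continuous images. *)
Definition rational_square (q : rat * rat * nat) : set (R * R) :=
  `[ratr q.1.1 - q.2.+1%:R^-1, ratr q.1.1 + q.2.+1%:R^-1]%classic `*`
  `[ratr q.1.2 - q.2.+1%:R^-1, ratr q.1.2 + q.2.+1%:R^-1]%classic.

Lemma open_bigcup_squares (U : set (R * R)) : open U ->
  U = \bigcup_(q in [set q | rational_square q `<=` U]) rational_square q.
Proof.
move=> oU; apply/seteqP; split; last by move=> x [q qU]; exact: qU.
move=> x Ux; have /nbhs_ballP[e /= e0 eU] : nbhs x U by apply: open_nbhs_nbhs.
(* A square of half-side below [e / 2] that contains [x] lies in the ball of radius [e] about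
   [x]. *)
have [j je] : exists j : nat, j.+1%:R^-1 < e / 2.
  by apply: inv_succ_lt; rewrite divr_gt0.
have j0 : 0 < j.+1%:R^-1 :> R by rewrite invr_gt0.
have [q1 q1x] := rat_approx x.1 _ j0; have [q2 q2x] := rat_approx x.2 _ j0.
move: q1x q2x; rewrite !ltr_norml => /andP[a1 a2] /andP[b1 b2].
exists (q1, q2, j); last first.
  by split; rewrite /= in_itv /=; apply/andP; split;
    move: a1 a2 b1 b2; move: (j.+1%:R^-1) => r *; lra.
move=> y [] /=; rewrite !in_itv /= => /andP[c1 c2] /andP[d1 d2].
apply: eU; split; rewrite -ball_normE /ball_ /= ltr_norml; apply/andP; split;
  move: a1 a2 b1 b2 c1 c2 d1 d2 je; move: (j.+1%:R^-1) => r *; lra.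
Qed.

Lemma rational_square_compact q : compact (rational_square q).
Proof. by apply: compact_setX; exact: segment_compact. Qed.

Lemma rational_square_measurable q : measurable (rational_square q : set T2).
Proof. by apply: measurableX; exact: measurable_itv. Qed.

Lemma countable_bigcup_measurable d (T : measurableType d) (I : countType)
    (P : set I) (F : I -> set T) :
  (forall i, P i -> measurable (F i)) -> measurable (\bigcup_(i in P) F i).
Proof.
move=> mF; rewrite bigcup_mkcond; apply: countable_bigcupT_measurable => // i.
by case: ifPn => // /set_mem; exact: mF.
Qed.

Lemma open2_measurable (U : set (R * R)) : open U -> measurable (U : set T2).
Proof.
move=> /open_bigcup_squares ->; apply: countable_bigcup_measurable => q _.
exact: rational_square_measurable.
Qed.

Lemma open3_measurable (V : set 'rV[R]_3) : open V ->
  measurable (V : set (borel3 R)).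
Proof. by move=> oV; apply: sub_sigma_algebra. Qed.

Lemma compact3_measurable (K : set 'rV[R]_3) : compact K ->
  measurable (K : set (borel3 R)).
Proof.
move=> /(compact_closed (@norm_hausdorff _ _)) /closed_openC /open3_measurable.
by move=> /measurableC; rewrite setCK.
Qed.

(* An open subset of the plane is sigma-compact, hence so is its image. *)
Lemma image_open_measurable (U : set (R * R)) (phi : R * R -> 'rV[R]_3) :
  open U -> (forall u, U u -> {for u, continuous phi}) ->
  measurable (phi @` U : set (borel3 R)).
Proof.
move=> oU cphi; rewrite (open_bigcup_squares U oU) image_bigcup.
apply: countable_bigcup_measurable => q qU; apply: compact3_measurable.
apply: continuous_compact; last exact: rational_square_compact.
by apply: continuous_in_subspaceT => u /set_mem qu; apply/cphi/qU.
Qed.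

Lemma open_preimage (W : topologicalType) (U : set (R * R)) (f : R * R -> W)
    (V : set W) : open U -> (forall u, U u -> {for u, continuous f}) ->
  open V -> open (U `&` f @^-1` V).
Proof.
move=> oU cf oV; rewrite openE => u [Uu Vfu].
apply: filterI; first exact: open_nbhs_nbhs.
by apply: cf => //; exact: open_nbhs_nbhs.
Qed.

Lemma continuous_measurable3 (U : set (R * R)) (f : R * R -> 'rV[R]_3) :
  open U -> (forall u, U u -> {for u, continuous f}) ->
  measurable_fun (U : set T2) (f : T2 -> borel3 R).
Proof.
move=> oU cf.
refine (@measurability _ _ _ (borel3 R) _ _ (@open 'rV[R]_3) erefl _).
move=> _ [V oV <-].
by apply: open2_measurable; exact: open_preimage.
Qed.

Lemma continuous_measurable1 (U : set (R * R)) (f : R * R -> R) :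
  open U -> (forall u, U u -> {for u, continuous f}) ->
  measurable_fun (U : set T2) (f : T2 -> measurableTypeR R).
Proof.
move=> oU cf; apply: (measurability _ (RGenOpens.measurableE R)).
move=> _ [_ [a [b ->]] <-].
by apply: open2_measurable; apply: open_preimage => //; exact: interval_open.
Qed.

Lemma rat_row_approx n (x : 'rV[R]_n) (e : R) : 0 < e ->
  exists q : 'rV[rat]_n, ball (map_mx (ratr : rat -> R) q : 'rV[R]_n) e x.
Proof.
move=> e0; have /choice[q qx] : forall i, exists q : rat, `|x 0 i - ratr q| < e.
  by move=> i; exact: rat_approx.
exists (\row_i q i); split => // i j; rewrite !mxE ord1 -ball_normE /ball_ /=.
by rewrite distrC.
Qed.

(** Balls with rational centres and radii [1 / (j + 1)] form a countable base. For each ball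
    contained in some set satisfying [P], one such set is chosen; [set0] is the default for the
    other balls and for integers that encode no ball. *)
Lemma lindelof_rV n (S : set 'rV[R]_n) (P : set 'rV[R]_n -> Prop) :
  (forall x, S x -> exists2 V, open_nbhs x V & P V) ->
  exists V : nat -> set 'rV[R]_n,
    (forall k, V k = set0 \/ P (V k)) /\ S `<=` \bigcup_k V k.
Proof.
move=> SP.
pose B (q : 'rV[rat]_n * nat) :=
  ball (map_mx (ratr : rat -> R) q.1 : 'rV[R]_n) q.2.+1%:R^-1.
have /choice[W WP] : forall q, exists W, (W = set0 \/ P W) /\
    ((exists2 V, P V & B q `<=` V) -> B q `<=` W).
  move=> q; have [[V PV qV]|nq] := pselect (exists2 V, P V & B q `<=` V).
    by exists V; split => //; right.
  by exists set0; split; [left|].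
exists (fun k => if unpickle k is Some q then W q else set0); split.
  by move=> k; case: unpickle => [q|]; [exact: (WP q).1|left].
move=> x /SP[V [oV Vx] PV].
have /nbhs_ballP[e /= e0 eV] : nbhs x V by apply: open_nbhs_nbhs.
have [j je] : exists j : nat, j.+1%:R^-1 < e / 2.
  by apply: inv_succ_lt; rewrite divr_gt0.
have j0 : 0 < j.+1%:R^-1 :> R by rewrite invr_gt0.
have [q qx] := rat_row_approx _ x _ j0.
exists (pickle (q, j)) => //; rewrite pickleK; apply: (WP (q, j)).2 => //.
exists V => // y qy; apply: eV.
have /ball_sym qx' := qx.
apply: (le_ball _ (ball_triangle qx' qy)).
by move: je; rewrite /=; move: (j.+1%:R^-1) => r *; lra.
Qed.

End Topology.

(** * Change of variables *)

Section Integration.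
Local Open Scope ereal_scope.
Import HBNNSimple.

(** A non-negative integral is a supremum over the simple functions below the integrand, and
    enlarging the integrand only adds candidates. This serves to compare with [sqrt (det G)] without
    establishing its measurability. *)
Lemma ge0_le_integral_nonmeasurable d (T : measurableType d) (R : realType)
    (mu : {measure set T -> \bar R}) (D : set T) (f g : T -> \bar R) :
  (forall x, D x -> 0 <= f x) -> (forall x, D x -> f x <= g x) ->
  \int[mu]_(x in D) f x <= \int[mu]_(x in D) g x.
Proof.
move=> f0 fg; rewrite !ge0_integralE//; last first.
  by move=> x Dx; rewrite (le_trans (f0 x Dx))// fg.
apply: ereal_sup_le => _ [h hf <-]; exists h => // x; apply: (le_trans (hf x)).
by rewrite /patch; case: ifPn => // /set_mem; exact: fg.
Qed.

Context d1 d2 (X : measurableType d1) (Y : measurableType d2) (R : realType).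
Context (lam : {measure set X -> \bar R}) (mu : {measure set Y -> \bar R}).
Context (U : set X) (phi : X -> Y) (w : X -> R) (C : set Y).
Hypotheses (mU : measurable U) (mC : measurable C).
Hypothesis UC : forall x, U x -> C (phi x).
Hypotheses (mphi : measurable_fun U phi) (mw : measurable_fun U w).
Hypothesis w0 : forall x, U x -> (0 <= w x)%R.
Hypothesis muE : forall A, measurable A -> A `<=` C ->
  mu A = \int[lam]_(x in U `&` phi @^-1` A) (w x)%:E.

(** On [C], [mu] is the image under [phi] of the measure with density [w]. Monotone convergence on
    both sides reduces the formula to simple functions, and linearity to indicators of level sets,
    where it is [muE]. *)
Lemma integral_density_image (f : Y -> \bar R) :
  measurable_fun C f -> (forall y, C y -> 0 <= f y) ->
  \int[mu]_(y in C) f y = \int[lam]_(x in U) (f (phi x) * (w x)%:E).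
Proof.
move=> mf f0.
have mwE : measurable_fun U (EFin \o w) by exact/measurable_EFinP.
have wE0 x : U x -> 0 <= (w x)%:E by move=> Ux; rewrite lee_fin w0.
pose f_ := nnsfun_approx mC mf.
have mcomp (h : {nnsfun Y >-> R}) :
    measurable_fun U (fun x => (h (phi x))%:E * (w x)%:E).
  apply: emeasurable_funM => //; apply/measurable_EFinP.
  exact: (measurableT_comp (measurable_funPT h) mphi).
transitivity (limn (fun n => \int[mu]_(y in C) (f_ n y)%:E)).
  rewrite -monotone_convergence//.
  - apply: eq_integral => y /[!inE] yC; apply/esym/cvg_lim => //.
    exact: cvg_nnsfun_approx.
  - by move=> n; apply/measurable_EFinP; exact: measurable_funTS.
  - by move=> n y _; rewrite lee_fin.
  - by move=> y _ m n mn; rewrite lee_fin; exact/lefP/nd_nnsfun_approx.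
transitivity (limn (fun n =>
    \int[lam]_(x in U) ((f_ n (phi x))%:E * (w x)%:E))); last first.
  rewrite -monotone_convergence//.
  - apply: eq_integral => x /[!inE] xU; apply/cvg_lim => //.
    by apply: cvgeZr => //; apply: cvg_nnsfun_approx => //; exact: UC.
  - by move=> n x Ux; apply: mule_ge0; [rewrite lee_fin|exact: wE0].
  - move=> x Ux m n mn; rewrite lee_wpmul2r ?wE0// lee_fin.
    exact/lefP/nd_nnsfun_approx.
congr (limn _); apply/funext => n.
have mlev r : measurable (f_ n @^-1` [set r]) by exact: measurable_funPTI.
have mind r : measurable_fun U
    (fun x => (\1_(f_ n @^-1` [set r]) (phi x))%:E * (w x)%:E).
  exact: (mcomp (indic_nnsfun R (mlev r))).
have sumE x : (f_ n (phi x))%:E * (w x)%:E = \sum_(r \in range (f_ n))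
    (r%:E * ((\1_(f_ n @^-1` [set r]) (phi x))%:E * (w x)%:E)).
  rewrite -EFinM [in LHS](fimfunE (f_ n) (phi x)) mulr_fsuml -fsumEFin//.
  by apply: eq_fsbigr => r _; rewrite -!EFinM mulrA.
under [RHS]eq_integral do rewrite sumE.
rewrite [RHS]ge0_integral_fsum//; last 2 first.
- by move=> r; exact: measurable_funeM.
- move=> r x Ux; rewrite muleA mule_ge0// ?wE0//.
  by rewrite -EFinM nnfun_muleindic_ge0.
under eq_integral do rewrite fimfunE -fsumEFin//.
rewrite ge0_integral_fsum//; last 2 first.
- move=> r; apply/measurable_EFinP; apply: measurable_funTS.
  exact: measurable_funM.
- by move=> r y _; rewrite nnfun_muleindic_ge0.
apply: eq_fsbigr => r _; rewrite integralZl_indic_nnsfun// integral_indic//.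
(* A negative level is never attained by the non-negative [f_ n], so both sides vanish; a
   non-negative [r] can be taken out of the integral. *)
have [r0|r0] := leP 0%R r; last first.
  rewrite preimage_nnfun0// set0I measure0 mule0 integral0_eq// => x _.
  by rewrite indic0 mul0e mule0.
rewrite ge0_integralZl//; last first.
  by move=> x Ux; rewrite mule_ge0 ?wE0// lee_fin.
congr (_ * _); rewrite setIC muE; last 2 first.
- exact: measurableI.
- exact: subIsetl.
rewrite integral_mkcondr; apply: eq_integral => x /[!inE] Ux.
rewrite /patch indicE.
have [fr|fr] := boolP (phi x \in f_ n @^-1` [set r]).
  by rewrite mul1e ifT// inE; split; [exact: UC|exact/set_mem].
rewrite mul0e ifF//; apply/negbTE; apply: contra fr; rewrite !inE.
by move=> -[].
Qed.

End Integration.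

(** * Sigma-finiteness of planar Lebesgue measure and Tonelli's theorem *)

Section PlaneMeasure.
Local Open Scope ereal_scope.
Context (R : realType).
Local Notation leb := (@lebesgue_measure R).
Local Notation T2 := (measurableTypeR R * measurableTypeR R)%type.

Lemma lebesgue2_sigma_finite : sigma_finite [set: T2] (leb \x leb).
Proof.
pose I (n : nat) : set (measurableTypeR R) := [set` `[- n%:R, n%:R]%R].
have mI n : measurable (I n) by exact: measurable_itv.
exists (fun n => I n `*` I n).
  apply/seteqP; split => // -[x y] _.
  pose n := Num.truncn (`|x| + `|y|)%R.
  have /ltW nxy : (`|x| + `|y| < n.+1%:R)%R by exact: truncnS_gt.
  exists n.+1 => //; split; rewrite /I /= in_itv /= -ler_norml.
    by apply: le_trans nxy; rewrite lerDl.
  by apply: le_trans nxy; rewrite lerDr.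
move=> n; split; first exact: measurableX.
have Ioo : leb (I n) < +oo.
  by rewrite /I lebesgue_measure_itv /=; case: ifP; rewrite ?ltry.
rewrite [ltLHS](product_measure1E leb leb (mI n) (mI n)).
by apply: lte_mul_pinfty => //; rewrite ge0_fin_numE.
Qed.

Let leb2 : {measure set T2 -> \bar R} := leb \x leb.

(** The measure [leb \x leb] itself, bundled with the sigma-finiteness that Tonelli's theorem
    requires. *)
Definition lebesgue2 : {sigma_finite_measure set T2 -> \bar R} :=
  HB.pack (Measure.sort leb2)
    (Measure_isSigmaFinite.Build _ _ _ leb2 lebesgue2_sigma_finite).

Lemma tonelli_lebesgue2 (f : T2 * measurableTypeR R -> \bar R) :
  measurable_fun setT f -> (forall x, 0 <= f x) ->
  \int[(leb \x leb) \x leb]_z f z = \int[leb \x leb]_u \int[leb]_t f (u, t).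
Proof.
by move=> mf f0; have := @fubini_tonelli1 _ _ _ _ _ lebesgue2 leb f mf f0.
Qed.

End PlaneMeasure.

(** * Volume of the layer over a chart *)

Section ChartVolume.
Context {R : realType}.

Local Notation leb := (@lebesgue_measure R).
Local Notation T2 := (measurableTypeR R * measurableTypeR R)%type.

Lemma measurable_fun_pair_on d d1 d2 (T : measurableType d)
    (X : measurableType d1) (Y : measurableType d2) (D : set T)
    (f : T -> X) (g : T -> Y) : measurable D ->
  measurable_fun D f -> measurable_fun D g ->
  measurable_fun D (fun x => (f x, g x)).
Proof.
move=> mD mf mg; refine (@measurability _ _ _ (X * Y)%type _ _
  (preimage_set_system setT fst measurable `|`
   preimage_set_system setT snd measurable) erefl _).
move=> _ [_ [[B mB <-]|[B mB <-]] <-]; rewrite setTI.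
- exact: mf.
- exact: mg.
Qed.

Context (S : set 'rV[R]_3) (U : set (R * R)) (phi : R * R -> 'rV[R]_3).
Hypothesis SU : local_param S U phi.

Let oU : open U. Proof. exact: (chart_open _ _ _ SU). Qed.
Let mU : measurable (U : set T2). Proof. exact: open2_measurable. Qed.
Let phis : smooth_on (@dir2 R) U phi.
Proof. exact: (chart_smooth _ _ _ SU). Qed.
Let mphi : measurable_fun (U : set T2) (phi : T2 -> borel3 R).
Proof.
apply: continuous_measurable3 => // u Uu.
exact (smooth_continuous _ _ u phis Uu).
Qed.

Let w (u : R * R) := Num.sqrt (\det (first_form phi u)).

Lemma first_form_measurable i j :
  measurable_fun (U : set T2)
    (fun u : T2 => first_form phi u i j : measurableTypeR R).
Proof.
have md i' k : measurable_fun (U : set T2)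
    (fun u : T2 => ('D_(@dir2 R i') phi u) 0 k : measurableTypeR R).
  apply: continuous_measurable1 => // u Uu.
  have := smooth_continuous _ _ u (smooth_derive _ _ i' phis) Uu => cD.
  exact: (continuous_comp cD (@coord_continuous _ _ _ 0 k _)).
under eq_fun do rewrite mxE /dotp.
apply: measurable_sum => k; apply: measurable_funM; exact: md.
Qed.

Lemma chart_density_measurable :
  measurable_fun (U : set T2) (w : T2 -> measurableTypeR R).
Proof.
apply: (@measurableT_comp _ _ _ _ _ _
  (Num.sqrt : measurableTypeR R -> measurableTypeR R)).
  by apply: continuous_measurable_fun; exact: sqrt_continuous.
under eq_fun do rewrite det2.
by apply: measurable_funB; apply: measurable_funM; exact: first_form_measurable.
Qed.

(** This set is the preimage of [E] under the map [(u, t) -> (phi u, t)] on [U * R], whose two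
    components are measurable. *)
Lemma chart_pullback_measurable (E : set (borel3 R * measurableTypeR R)) :
  measurable E ->
  measurable ([set ut | U ut.1 /\ E (phi ut.1, ut.2)] :
     set (T2 * measurableTypeR R)).
Proof.
move=> mE.
have mD : measurable ((U : set T2) `*` [set: measurableTypeR R]).
  by apply: measurableX.
have := @measurable_fun_pair_on _ _ _ _ (borel3 R) (measurableTypeR R)
  ((U : set T2) `*` [set: measurableTypeR R]) (phi \o fst) snd mD.
have m1 : measurable_fun ((U : set T2) `*` [set: measurableTypeR R])
    ((phi \o fst) : T2 * measurableTypeR R -> borel3 R).
  apply: (measurable_comp mU _ mphi) => //; first by move=> _ [x [Ux _] <-].
  exact: measurable_funTS.
have m2 : measurable_fun ((U : set T2) `*` [set: measurableTypeR R])
    (snd : T2 * measurableTypeR R -> measurableTypeR R).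
  exact: measurable_funTS.
move=> /(_ m1 m2) /(_ mD E mE).
set A := (X in measurable X); set B := (X in _ -> measurable X).
suff -> : B = A by [].
by apply/seteqP; split => -[u t] /=; [move=> [Uu Eu]|move=> [[Uu _] Eu]].
Qed.

(** The product measure integrates the lengths of the sections of [E], which are empty off the chart
    image. The density formula moves this integral to [U], and Tonelli's theorem recombines it with
    the integral in [t]. *)
Lemma chart_product_volume (mu : {measure set (borel3 R) -> \bar R})
    (E : set (borel3 R * measurableTypeR R)) :
  (forall A : set (borel3 R), measurable A -> A `<=` phi @` U ->
     mu A = (\int[leb \x leb]_(u in U `&` phi @^-1` A) (w u)%:E)%E) ->
  measurable E -> (forall xt, E xt -> (phi @` U) xt.1) ->
  (mu \x leb)%E E = (\int[(leb \x leb) \x leb]_(ut in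
    [set ut | U ut.1 /\ E (phi ut.1, ut.2)]) (w ut.1)%:E)%E.
Proof.
move=> muE mE EU.
have w0 u : 0 <= w u by exact: sqrtr_ge0.
pose C : set (borel3 R) := phi @` U.
have mC : measurable C.
  apply: image_open_measurable => // u Uu.
  exact (smooth_continuous _ _ u phis Uu).
pose f (x : borel3 R) := leb (xsection E x).
have mf : measurable_fun setT f by exact: measurable_fun_xsection.
have -> : (mu \x leb)%E E = (\int[mu]_(x in C) f x)%E.
  rewrite /product_measure1 [RHS]integral_mkcond; apply: eq_integral => x _.
  rewrite /patch; case: ifPn => // /negP xC /=.
  suff -> : xsection E x = set0 by rewrite measure0.
  apply/seteqP; split => // t /mem_set; rewrite mem_xsection => /set_mem Ext.
  by apply: xC; apply/mem_set; exact: (EU _ Ext).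
rewrite (@integral_density_image _ _ _ _ _ (leb \x leb)%E mu U phi w C)//.
- rewrite [LHS]integral_mkcond [RHS]integral_mkcond.
  rewrite [RHS]tonelli_lebesgue2.
  + apply: eq_integral => u _; rewrite /patch.
    have [/set_mem Uu|/negP nUu] := boolP (u \in U); last first.
      rewrite integral0_eq// => t _; rewrite ifF//.
      apply/negP => /set_mem [/= Uu _].
      by apply: nUu; exact/mem_set.
    (* For fixed [u], the length of the section is written as the integral of its indicator, and the
       constant weight [w u] goes inside. *)
    transitivity (\int[leb]_t ((w u)%:E * (\1_(xsection E (phi u)) t)%:E))%E.
      have mx : measurable (xsection E (phi u)) by exact: measurable_xsection.
      rewrite ge0_integralZl_EFin ?w0//; last first.
        by apply/measurable_EFinP; exact: measurable_indic.
      by rewrite integral_indic// setIT muleC.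
    apply: eq_integral => t _; rewrite indicE mem_xsection.
    have [Eut|nEut] := boolP ((phi u, t) \in E).
      by rewrite mule1 ifT//; apply/mem_set; split => //; exact/set_mem.
    rewrite mule0 ifF//; apply/negP => /set_mem [_ /= Eut].
    by move/negP : nEut; apply; exact/mem_set.
  + have mT := chart_pullback_measurable E mE.
    apply/(measurable_restrictT _ mT)/measurable_EFinP.
    apply: (measurable_comp mU _ chart_density_measurable).
      by move=> _ [ut [Uu _] <-].
    exact: measurable_funTS.
  + by move=> ut; rewrite /patch; case: ifP; rewrite ?lee_fin.
- by move=> u Uu; exists u.
- exact: chart_density_measurable.
- exact: measurable_funTS.
Qed.

Context (N : 'rV[R]_3 -> 'rV[R]_3) (NS : unit_normal_field S N).

(** In the chart both measures of [E] are integrals over the same set [T], so the pointwise bounds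
    between the densities suffice. *)
Lemma chart_layer_volume_bounds (a eps : R) (K : set 'rV[R]_3)
    (dSigma : {measure set (borel3 R) -> \bar R})
    (dOmega : {measure set (borel3 R * measurableTypeR R)%type -> \bar R}) :
  0 < a -> 0 < eps -> eps < 1 ->
  (forall u, U u -> ~ K (phi u) -> second_form_norm N phi u < eps / 3 / a) ->
  surface_volume S dSigma -> layer_volume S N a dOmega ->
  forall E : set (borel3 R * measurableTypeR R), measurable E ->
  E `<=` layer (phi @` U `\` K) a ->
  (((1 - eps) ^+ 2)%:E * (dSigma \x leb) E <= dOmega E)%E /\
  (dOmega E <= ((1 + eps) ^+ 2)%:E * (dSigma \x leb) E)%E.
Proof.
move=> a0 eps0 eps1 BK [_ /(_ _ _ SU) dS] [_ /(_ _ _ SU) dO] E mE EK.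
have EU : E `<=` layer (phi @` U) a.
  by move=> xt /EK[[? _] ?]; split.
rewrite (chart_product_volume dSigma E dS mE) => [|xt /EU[]//].
rewrite dO//.
have mT := chart_pullback_measurable E mE.
set T := [set ut | _] in mT *.
have w0 u : 0 <= w u by exact: sqrtr_ge0.
have mwT : measurable_fun (T : set (T2 * measurableTypeR R))
    (fun ut : T2 * measurableTypeR R => (w ut.1)%:E).
  apply/measurable_EFinP.
  apply: (measurable_comp mU _ chart_density_measurable).
    by move=> _ [ut [Uu _] <-].
  exact: measurable_funTS.
have bnd (ut : R * R * R) : T ut ->
  (1 - eps) ^+ 2 * w ut.1 <= Num.sqrt (\det (layer_metric N phi ut.1 ut.2)) <=
  (1 + eps) ^+ 2 * w ut.1.
  move=> [Uu /EK[[_ nK] /= ta]].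
  apply: (sqrt_det_layer_metric_bounds S N U phi SU NS a eps) => //.
  exact: BK.
split.
- rewrite -ge0_integralZl_EFin ?sqr_ge0//; last by move=> *; rewrite lee_fin.
  apply: ge0_le_integral_nonmeasurable => ut Tut.
    by rewrite lee_fin mulr_ge0// sqr_ge0.
  by rewrite lee_fin; have /andP[] := bnd ut Tut.
- rewrite -ge0_integralZl_EFin ?sqr_ge0//; last by move=> *; rewrite lee_fin.
  apply: ge0_le_integral_nonmeasurable => ut Tut; rewrite lee_fin ?sqrtr_ge0//.
  by have /andP[] := bnd ut Tut.
Qed.

End ChartVolume.

(** * Comparison of the metrics and of the volumes *)

Theorem proposition2p2 (R : realType) (Sigma : set 'rV[R]_3)
    (N : 'rV[R]_3 -> 'rV[R]_3) (a : R)
    (Sigma_surface : regular_surface Sigma)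
    (Sigma_orientable : orientable Sigma)
    (Sigma_complete : complete_surface Sigma)
    (Sigma_noncompact : ~ compact Sigma)
    (N_normal : unit_normal_field Sigma N)
    (Sigma_not_tot_geod : ~ totally_geodesic Sigma N)
    (B_vanishes : second_form_vanishes_at_infinity Sigma N)
    (a_gt0 : 0 < a)
    (a_embedding : layer_embedding Sigma N a)
    (eps : R) (eps_gt0 : 0 < eps) (eps_lt1 : eps < 1) :
  exists K : set 'rV[R]_3,
    [/\ compact_subset Sigma K,
        (forall (U : set (R * R)) (phi : R * R -> 'rV[R]_3),
           local_param Sigma U phi ->
         forall (u : R * R) (t : R), U u -> ~ K (phi u) -> t \in `[- a, a] ->
           mx_le ((1 - eps) *: first_form phi u) (layer_metric2 N phi u t) /\
           mx_le (layer_metric2 N phi u t) ((1 + eps) *: first_form phi u)) &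
        (forall (dSigma : {measure set (borel3 R) -> \bar R})
                (dOmega :
                   {measure set (borel3 R * measurableTypeR R)%type -> \bar R}),
           surface_volume Sigma dSigma ->
           layer_volume Sigma N a dOmega ->
         forall E : set (borel3 R * measurableTypeR R), measurable E ->
           E `<=` layer (Sigma `\` K) a ->
           (((1 - eps) ^+ 2)%:E * (dSigma \x (@lebesgue_measure R)) E
              <= dOmega E)%E /\
           (dOmega E
              <= ((1 + eps) ^+ 2)%:E * (dSigma \x (@lebesgue_measure R)) E)%E)].
Proof.
have d0 : 0 < eps / 3 / a by rewrite !divr_gt0.
have [K [KS BK]] := B_vanishes _ d0.
exists K; split => //.
  move=> U phi SU u t Uu nK ta.
  apply: (layer_metric_bounds Sigma N U phi SU N_normal a) => //.
  exact: (BK U phi SU).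
move=> dSigma dOmega dS dO E mE EK.
(* Each chart image is cut out of [Sigma] by an open set of the ambient space, so the Lindelof
   property of that space yields countably many charts covering [Sigma]. *)
pose chart_image (V : set 'rV[R]_3) :=
  exists U phi, local_param Sigma U phi /\ V `&` Sigma = phi @` U.
have [V [Vc SV]] : exists V : nat -> set 'rV[R]_3,
    (forall k, V k = set0 \/ chart_image (V k)) /\ Sigma `<=` \bigcup_k V k.
  apply: lindelof_rV => x /[dup] Sx /Sigma_surface[U [phi [SU xU]]].
  case: (SU) => _ _ _ [V oV UV] _; exists V.
    by split => //; move: xU; rewrite UV => -[].
  by exists U, phi; split => //; rewrite setIC UV.
pose C k : set (borel3 R) := V k `&` Sigma.
have mC k : measurable (C k).
  case: (Vc k) => [V0|[U [phi [SU VU]]]]; first by rewrite /C V0 set0I.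
  rewrite /C VU; apply: image_open_measurable.
    exact: (chart_open _ _ _ SU).
  by move=> u Uu; exact: (smooth_continuous _ _ _ (chart_smooth _ _ _ SU) Uu).
(* [seqDU] removes from each [C k] the preceding ones, so the pieces are disjoint and each lies over
   a single chart; countable additivity then sums their estimates. *)
pose F k : set (borel3 R * measurableTypeR R) := E `&` (seqDU C k `*` setT).
have mF k : measurable (F k).
  apply: measurableI => //; apply: measurableX => //.
  exact: seqDU_measurable.
have tF : trivIset setT F.
  move=> i j _ _ [[x t] [[_ [Ci _]] [_ [Cj _]]]].
  by apply: (@trivIset_seqDU _ C i j) => //; exists x.
have EF : E = \bigcup_k F k.
  apply/seteqP; split => [[x t] Ext|xt [k _ []]//].
  have [[Sx _] _] := EK _ Ext; have [k _ Vx] := SV x Sx.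
  have : (\bigcup_k C k) x by exists k.
  by rewrite seqDU_bigcup_eq => -[j _ Cj]; exists j.
have FK k : (((1 - eps) ^+ 2)%:E * (dSigma \x @lebesgue_measure R) (F k)
      <= dOmega (F k))%E /\
    (dOmega (F k)
      <= ((1 + eps) ^+ 2)%:E * (dSigma \x @lebesgue_measure R) (F k))%E.
  case: (Vc k) => [V0|[U [phi [SU VU]]]].
    suff -> : F k = set0 by rewrite !measure0 !mule0.
    apply/seteqP; split => // -[x t] [_ [[Cx _] _]].
    by move: Cx; rewrite /C V0 set0I.
  apply: (chart_layer_volume_bounds _ _ _ SU _ N_normal a eps K) => //.
    exact: (BK U phi SU).
  move=> [x t] [Ext [[Cx _] _]]; have [[Sx nKx] ta] := EK _ Ext.
  by split => //; split => //; rewrite -VU.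
rewrite EF !measure_bigcup//.
split; rewrite -nneseriesZl//; apply: lee_nneseries => //.
- by move=> k _ _; rewrite mule_ge0// lee_fin sqr_ge0.
- by move=> k _; case: (FK k).
- by move=> k _; case: (FK k).
Qed.
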